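(* Let $\mathcal{A}$ be a finite alphabet, let $\Omega \subseteq \mathcal{A}^{\mathbb{Z}}$ be a subshift, and let $\mu$ be an $S$-ergodic probability measure on $\Omega$. Then there exist $R_\mu, T_\mu \in [1,\infty]$ such that $R(\omega) = R_\mu$ and $T(\omega) = T_\mu$ for $\mu$-almost every $\omega \in \Omega$.
   Context: $\mathcal{A}$ carries the discrete topology and $\mathcal{A}^{\mathbb{Z}}$ the product topology. The shift $S$ on $\mathcal{A}^{\mathbb{Z}}$ is $(S\omega)_k = \omega_{k+1}$. A subshift is a closed, $S$-invariant subset $\Omega$ of $\mathcal{A}^{\mathbb{Z}}$. An $S$-ergodic measure is an $S$-invariant Borel measure that is ergodic for $S$. For $\omega \in \mathcal{A}^{\mathbb{Z}}$ and $n \ge 1$ define $$R_n(\omega) = 1 + \frac{1}{n} \sup \{ m : \omega_k = \omega_{k+n} \text{ for } 1 \le k \le m \},$$ $$T_n(\omega) = 1 + \frac{1}{n} \sup \{ m : \omega_k = \omega_{k+n} \text{ and } \omega_{n+1-k} = \omega_{1-k} \text{ for } 1 \le k \le m \},$$ where $m$ ranges over positive integers and $\sup\emptyset = 0$, and set $R(\omega) = \limsup_{n\to\infty} R_n(\omega)$ and $T(\omega) = \limsup_{n \to \infty} T_n(\omega)$, which are elements of $[1,\infty]$. *)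

(* Defs.v *)
From HB Require Import structures.
From mathcomp Require Import all_boot all_order all_algebra.
From mathcomp Require Import all_classical all_reals all_analysis.
Set Implicit Arguments.
Unset Strict Implicit.
Unset Printing Implicit Defensive.
Import Order.TTheory GRing.Theory Num.Theory.
Import numFieldNormedType.Exports.

Local Open Scope classical_set_scope.
Local Open Scope ring_scope.

Definition fullshift (A : Type) : Type := {ptws int -> discrete_topology A}.

HB.instance Definition _ (A : choiceType) := Topological.on (fullshift A).
HB.instance Definition _ (A : pointedType) := Pointed.on (fullshift A).

(* The bi-infinite sequences over A with their Borel sigma-algebra.  The library
   requires measurable spaces to be pointed, hence pointedType; this only
   excludes the empty alphabet, which carries no probability measure on A^Z. *)
Definition borel_fullshift (A : pointedType) :=
  g_sigma_algebraType (@open (fullshift A)).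

HB.instance Definition _ (A : pointedType) := Measurable.on (borel_fullshift A).

Definition shift (A : Type) (w : fullshift A) : fullshift A :=
  fun k : int => w (k + 1).

(* Only S(Omega) <= Omega is required, so subsets with S(Omega) = Omega are
   covered as well. *)
Definition subshift (A : choiceType) (Omega : set (fullshift A)) : Prop :=
  closed Omega /\ (@shift A) @` Omega `<=` Omega.

Definition shift_invariant (A : pointedType) (R : realType)
    (mu : probability (borel_fullshift A) R) : Prop :=
  forall B : set (borel_fullshift A), measurable B ->
    mu ((@shift A) @^-1` B) = mu B.

Definition shift_ergodic (A : pointedType) (R : realType)
    (mu : probability (borel_fullshift A) R) : Prop :=
  shift_invariant mu /\
  forall B : set (borel_fullshift A), measurable B ->
    (@shift A) @^-1` B = B -> mu B = 0%E \/ mu B = 1%E.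

(* Supremum of the positive integers satisfying P, with sup of the empty set
   equal to 0 (ereal_sup set0 is -oo). *)
Definition sup_pos (R : realType) (P : nat -> Prop) : \bar R :=
  ereal_sup (0%E |` [set m%:R%:E | m in [set m : nat | (0 < m)%N /\ P m]]).

Definition R_match (A : Type) (w : fullshift A) (n m : nat) : Prop :=
  forall k : nat, (1 <= k <= m)%N -> w k%:Z = w (k%:Z + n%:Z).

Definition T_match (A : Type) (w : fullshift A) (n m : nat) : Prop :=
  forall k : nat, (1 <= k <= m)%N ->
    w k%:Z = w (k%:Z + n%:Z) /\ w (n%:Z + 1 - k%:Z) = w (1 - k%:Z).

Definition R_index (R : realType) (A : Type) (n : nat) (w : fullshift A)
    : \bar R :=
  (1 + (n%:R^-1)%:E * sup_pos R (R_match w n))%E.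

Definition T_index (R : realType) (A : Type) (n : nat) (w : fullshift A)
    : \bar R :=
  (1 + (n%:R^-1)%:E * sup_pos R (T_match w n))%E.

(* The sequences start at n = 1. *)
Definition R_limsup (R : realType) (A : Type) (w : fullshift A) : \bar R :=
  limn_esup (fun n => R_index R n.+1 w).

Definition T_limsup (R : realType) (A : Type) (w : fullshift A) : \bar R :=
  limn_esup (fun n => T_index R n.+1 w).

(* Main.v *)
Require Import Defs.
From mathcomp Require Import all_boot all_order all_algebra.
From mathcomp Require Import all_classical all_reals all_analysis.
From mathcomp Require Import measurable_realfun zify.
Import Order.TTheory GRing.Theory Num.Theory.
Local Open Scope classical_set_scope.
Local Open Scope ereal_scope.

(** Both exponents have the form [limsup_n (1 + sup {m > 0 : P w n m} / n)]
    where the property [P w n m] says that certain coordinates of [w] indexed by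
    a window of size governed by [m] agree with their translates by [n].  Moving
    the origin by one step costs at most one unit of the window: [P w n m.+1]
    implies [P (S w) n m].  Hence the supremum drops by at most 1 under the
    shift, the normalised quantity by at most [1 / n], and in the limit the
    exponent [f] satisfies [f <= f \o S] everywhere ([match_exponent_shift]).

    Invariance of the measure upgrades this inequality to constancy.  For each
    [q] the set [B = {f > q}] satisfies [B `<=` S^-1 B], so the preimages
    [S^-n B] increase, all have the measure of [B], and their union is strictly
    invariant; ergodicity gives it, hence [B], measure 0 or 1
    ([subinvariant_set_trivial]).  For almost every [w] the answers to all the
    questions [q < f w], [q] rational, are therefore prescribed by the measure,
    and these answers determine [f w] ([subinvariant_ae_cst]).

    Measurability holds because each condition [w i = w j] cuts out an open set
    and the exponent is built from countably many such conditions by suprema and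
    an upper limit ([measurable_match_exponent]). *)

(** * Extended reals *)

Lemma ereal_rat_between (R : realType) (x y : \bar R) :
  x < y -> exists q : rat, x <= (ratr q : R)%:E < y.
Proof.
case: x y => [x| |] [y| |] //= xy.
- have /rat_in_itvoo[q] : (x < y)%R by rewrite -lte_fin.
  by rewrite in_itv/= => /andP[xq qy]; exists q; rewrite lee_fin lte_fin ltW.
- have /rat_in_itvoo[q] : (x < x + 1)%R by rewrite ltrDl.
  by rewrite in_itv/= => /andP[xq _]; exists q; rewrite lee_fin ltW// ltry.
- have /rat_in_itvoo[q] : (y - 1 < y)%R by rewrite gtrBl.
  by rewrite in_itv/= => /andP[_ qy]; exists q; rewrite leNye lte_fin.
- by exists 0%R; rewrite leNye ltry.
Qed.

(** A vanishing perturbation does not affect upper limits.  No subtraction of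
    [u] and [v] is involved, so the values [+oo] and [-oo] are harmless. *)
Lemma limn_esup_le_near0 (R : realType) (u v : nat -> \bar R) (eps : nat -> R) :
  (forall n, u n <= v n + (eps n)%:E) -> eps @ \oo --> 0%R ->
  limn_esup u <= limn_esup v.
Proof.
move=> uv eps0; apply/lee_addgt0Pr => e e0.
rewrite -leeBlDr//.
rewrite (limn_esup_lim v); apply: lime_ge; first exact: is_cvg_esups.
have epse : \forall n \near \oo, (eps n < e)%R.
  exact: cvgr_lt eps0 _ e0.
case: epse => N _ epse; exists N => // n /= Nn.
rewrite EFinN leeBlDr//; apply: (@le_trans _ _ (esups u n)).
  rewrite /limn_esup limf_esupE; apply: ereal_inf_lbound.
  by exists [set k | (n <= k)%N] => //; exists n.
apply: ge_ereal_sup => _ [k /= nk <-].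
apply: (le_trans (uv k)); apply: leeD.
  by apply: ereal_sup_ubound; exists k.
by rewrite lee_fin ltW//; apply: epse => /=; exact: leq_trans nk.
Qed.

(** * Functions that do not decrease along an ergodic map *)

Section Ergodicity.
Variables (d : measure_display) (T : measurableType d) (R : realType).
Variables (mu : probability T R) (theta : T -> T).
Hypothesis mtheta : measurable_fun setT theta.
Hypothesis invmu : forall B, measurable B -> mu (theta @^-1` B) = mu B.
Hypothesis ergmu : forall B, measurable B -> theta @^-1` B = B ->
  mu B = 0 \/ mu B = 1.

(** The hypothesis of ergodicity only speaks of sets equal to their preimage;
    the increasing union of the iterated preimages of [B] is such a set, and by
    continuity from below it has the same measure as [B]. *)
Lemma subinvariant_set_trivial (B : set T) : measurable B ->
  B `<=` theta @^-1` B -> mu B = 0 \/ mu B = 1.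
Proof.
move=> mB sB.
have mpre (C : set T) : measurable C -> measurable (theta @^-1` C).
  by move=> mC; rewrite -[X in measurable X]setTI; exact: mtheta.
pose F n := iter n (fun C : set T => theta @^-1` C) B.
have mF n : measurable (F n) by elim: n => //= n; exact: mpre.
have sF n : F n `<=` F n.+1.
  by elim: n => [|n IH] //= x; exact: IH.
have muF n : mu (F n) = mu B by elim: n => //= n <-; exact: invmu.
have mU : measurable (\bigcup_n F n) by exact: bigcupT_measurable.
have ndF : nondecreasing_seq F.
  by apply/nondecreasing_seqP => n; apply/subsetPset; exact: sF.
have -> : mu B = mu (\bigcup_n F n).
  have /cvg_lim <- // := nondecreasing_cvg_mu (mu := mu) mF mU ndF.
  by rewrite (_ : mu \o F = cst (mu B)) ?lim_cst//; apply/funext => n /=.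
apply: ergmu => //; apply/seteqP; split => x /= [n _ Fx].
  by exists n.+1.
by exists n => //; exact: sF.
Qed.

(** The constant is produced as the value at a point [x0] that lies in the full
    measure set where every comparison with a rational has its almost sure
    outcome: any other point of that set has the same rational cut as [x0]. *)
Lemma subinvariant_ae_cst (f : T -> \bar R) : measurable_fun setT f ->
  (forall x, f x <= f (theta x)) ->
  exists x0, {ae mu, forall x, f x = f x0}.
Proof.
move=> mf fth.
pose B (q : rat) := [set x | (ratr q : R)%:E < f x].
have mB q : measurable (B q).
  rewrite -[X in measurable X]setTI.
  exact: emeasurable_fun_o_infty.
have B01 q : mu (B q) = 0 \/ mu (B q) = 1.
  by apply: subinvariant_set_trivial => // x /= /lt_le_trans; exact.
have aeB q : {ae mu, forall x, B q x <-> mu (B q) = 1}.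
  have [muB|muB] := B01 q.
    exists (B q); split => // x /= nx; apply: contrapT => nB; apply: nx.
    split => // /esym/eqP; rewrite muB.
    by rewrite onee_eq0.
  exists (~` B q); split; first exact: measurableC.
    by rewrite probability_setC// muB subee.
  by move=> x /= nx Bx; apply: nx.
have : {ae mu, forall x, forall q, B q x <-> mu (B q) = 1}.
  (* almost sure statements are closed under conjunctions indexed by nat, hence
     the enumeration of the rationals by unpickle *)
  have aeP n : {ae mu, forall x, if unpickle n is Some q then
      B q x <-> mu (B q) = 1 else True}.
    by case: (unpickle n) => [q|]; [exact: aeB|exact: aeW].
  have := ae_foralln aeP; apply: filterS => x Px q.
  by have := Px (pickle q); rewrite pickleK.
move=> aeG; have muT : 0 < mu setT by rewrite probability_setT.
have [x0 Gx0] := @filter_ex _ _ (ae_properfilter_algebraOfSetsType muT) _ aeG.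
exists x0; apply: filterS aeG => x Gx.
wlog lex : x x0 Gx Gx0 / f x <= f x0 => [hw|].
  by have [|/ltW] := leP (f x) (f x0) => le0; [exact: hw|exact/esym/hw].
apply/eqP; rewrite eq_le lex leNgt; apply/negP.
move=> /ereal_rat_between[q /andP[xq qx0]].
have /Gx : mu (B q) = 1 by apply/Gx0.
by rewrite /B /= ltNge xq.
Qed.

End Ergodicity.

(** * The shift on the space of sequences *)

Lemma continuous_to_prod (X : topologicalType) (I : Type)
    (K : I -> topologicalType) (f : X -> prod_topology K) :
  (forall i, continuous (fun x => f x i)) -> continuous f.
Proof.
move=> cf x; apply/cvg_sup => i U [V] [[W] oW <-] Wfx WU.
by apply: filterS WU _; apply: (cf i x); exact: open_nbhs_nbhs.
Qed.

Section Shift.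
Variable A : pointedType.

Lemma coord_continuous (i : int) :
  continuous (fun w : fullshift A => w i : discrete_topology A).
Proof. exact: (@proj_continuous int (fun=> discrete_topology A) i). Qed.

Lemma shift_continuous :
  continuous (@Defs.shift A : fullshift A -> fullshift A).
Proof.
apply: (@continuous_to_prod (fullshift A) int (fun=> discrete_topology A)) => i.
exact: coord_continuous.
Qed.

Lemma measurable_shift :
  measurable_fun setT (@Defs.shift A : borel_fullshift A -> borel_fullshift A).
Proof.
apply: (@measurability _ _ (borel_fullshift A) (borel_fullshift A) setT _
  (@open (fullshift A))) => //.
move=> _ [U oU <-]; rewrite setTI; apply: sub_sigma_algebra.
by move/continuousP : shift_continuous; exact.
Qed.

(** The set is open, being the union over the letters [a] of the open sets
    where both coordinates equal [a]; openness spares counting the letters. *)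
Lemma measurable_coord_eq (i j : int) :
  measurable [set w : borel_fullshift A | w i = w j].
Proof.
rewrite (_ : [set w | _] = \bigcup_(a : A)
  ([set w : fullshift A | w i = a] `&` [set w : fullshift A | w j = a])).
  apply: sub_sigma_algebra; apply: bigcup_open => a _.
  have open_cylinder k : open [set w : fullshift A | w k = a].
    have /continuousP := coord_continuous k.
    by move=> /(_ [set a]); apply; exact: discrete_open.
  exact: openI.
apply/seteqP; split => [w /= wij|w [a _ [/= -> ->]]//].
by exists (w i).
Qed.

End Shift.

(** * Exponents attached to a matching condition *)

Section MatchExponent.
Variables (R : realType) (A : pointedType).
Variable P : fullshift A -> nat -> nat -> Prop.

(** [R_limsup] and [T_limsup] are, by conversion, the instances where [P] is
    [R_match] and [T_match]. *)
Definition match_exponent (w : fullshift A) : \bar R :=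
  limn_esup (fun n => 1 + (n.+1%:R^-1)%:E * sup_pos R (P w n.+1)).

(** Writes the supremum over an index set depending on [Q] as one over all
    [m], so that it becomes a countable supremum of measurable functions when
    [Q] depends on a point.  The term [m = 0] accounts for the value 0 that
    [sup_pos] adds by convention. *)
Lemma sup_pos_esups (Q : nat -> Prop) :
  sup_pos R Q = esups (fun m => (m%:R * \1_[set m | Q m] m)%:E) 0%N.
Proof.
apply/eqP; rewrite eq_le; apply/andP; split; apply: ge_ereal_sup => x.
  case=> [->|[m /= [m0 Qm] <-]]; apply: ereal_sup_ubound.
    by exists 0%N => //=; rewrite mul0r.
  by exists m => //=; rewrite indicE mem_set// mulr1.
move=> [m _ <-]; apply: ereal_sup_ubound.
rewrite indicE; case: m => [|m]; first by left; rewrite mul0r.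
have [Qm|nQm] := boolP (m.+1 \in _); last by left; rewrite mulr0.
by right; exists m.+1; [split => //; move: Qm; rewrite inE|rewrite mulr1].
Qed.

Lemma sup_pos_ge0 (Q : nat -> Prop) : 0 <= sup_pos R Q.
Proof. by apply: ereal_sup_ubound; left. Qed.

Lemma sup_pos_succ (Q Q' : nat -> Prop) :
  (forall m, Q m.+1 -> Q' m) -> sup_pos R Q <= sup_pos R Q' + 1.
Proof.
move=> QQ'; apply: ge_ereal_sup => _ [->|[[|m] /= [//_ Qm] <-]].
  by rewrite adde_ge0// sup_pos_ge0.
rewrite -natr1 EFinD leeD2r//; case: m Qm => [|m] Qm.
  exact: sup_pos_ge0.
by apply: ereal_sup_ubound; right; exists m.+1 => //=; split => //; exact: QQ'.
Qed.

Lemma match_exponent_ge1 w : 1 <= match_exponent w.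
Proof.
rewrite /match_exponent limn_esup_lim; apply: lime_ge; first exact: is_cvg_esups.
apply: nearW => n.
apply: (@le_trans _ _ (1 + (n.+1%:R^-1)%:E * sup_pos R (P w n.+1))).
  by rewrite leeDl// mule_ge0// sup_pos_ge0.
by apply: ereal_sup_ubound; exists n => /=.
Qed.

Lemma match_exponent_shift :
  (forall w n m, P w n m.+1 -> P (Defs.shift w) n m) ->
  forall w, match_exponent w <= match_exponent (Defs.shift w).
Proof.
move=> Pshift w.
apply: (@limn_esup_le_near0 _ _ _ (fun n => n.+1%:R^-1)%R).
  move=> n; rewrite -addeA leeD2l//.
  rewrite -[X in _ <= _ + X]mule1 -ge0_muleDr ?sup_pos_ge0//.
  by rewrite lee_pmul2l ?lte_fin ?invr_gt0//; exact/sup_pos_succ/Pshift.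
exact: cvg_harmonic.
Qed.

Lemma measurable_match_exponent :
  (forall n m, measurable [set w : borel_fullshift A | P w n m]) ->
  measurable_fun setT (match_exponent : borel_fullshift A -> \bar R).
Proof.
move=> mP; apply: (measurable_fun_limn_esup (f := fun n w => _)) => n.
apply: emeasurable_funD => //; apply: emeasurable_funM => //.
under eq_fun do rewrite sup_pos_esups.
apply: (measurable_fun_esups (f := fun m w => _)) => m.
apply/measurable_EFinP; apply: measurable_funM => //.
exact: (measurable_indic (mP n.+1 m)).
Qed.

End MatchExponent.

(** * The two matching conditions *)

Section Matches.
Variable A : pointedType.

Lemma R_match_shift (w : fullshift A) n m :
  R_match w n m.+1 -> R_match (Defs.shift w) n m.
Proof.
move=> M k /andP[k1 km]; rewrite /Defs.shift addrAC -PoszD addn1.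
exact: (M k.+1 km).
Qed.

(** [T_match w n m] says that [w j = w (j + n)] for [1 - m <= j <= m].  The shift
    by one turns this window into [- m <= j <= m - 1], which contains the
    window of radius [m - 1]. *)
Lemma T_match_shift (w : fullshift A) n m :
  T_match w n m.+1 -> T_match (Defs.shift w) n m.
Proof.
move=> M k /andP[k1 km]; rewrite /Defs.shift; split.
  rewrite addrAC -PoszD addn1.
  by have [-> _] := M k.+1 km.
(* the backward condition at [k] for the shifted sequence concerns
     [j = 2 - k]: for [k = 1] this is the forward condition at 1 for [w], for
     larger [k] the backward condition at [k - 1] *)
case: k k1 km => [//|[|k]] _ km.
  have [w1 _] := M 1%N isT.
  by transitivity (w (1%:Z + n%:Z)%R); [congr w; lia|rewrite -w1; congr w; lia].
have [_ wk] := M k.+1 (ltnW (ltnW km)).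
transitivity (w (n%:Z + 1 - k.+1%:Z)%R); first by congr w; lia.
by rewrite wk; congr w; lia.
Qed.

Lemma measurable_R_match n m :
  measurable [set w : borel_fullshift A | R_match w n m].
Proof.
rewrite (_ : [set w | _] = \bigcap_(k in [set k | (1 <= k <= m)%N])
  [set w : borel_fullshift A | w (Posz k) = w (k%:Z + n%:Z)%R])//.
by apply: bigcap_measurableType => k _; exact: measurable_coord_eq.
Qed.

Lemma measurable_T_match n m :
  measurable [set w : borel_fullshift A | T_match w n m].
Proof.
rewrite (_ : [set w | _] = \bigcap_(k in [set k | (1 <= k <= m)%N])
  ([set w : borel_fullshift A | w (Posz k) = w (k%:Z + n%:Z)%R] `&`
   [set w | w (n%:Z + 1 - k%:Z)%R = w (1 - k%:Z)%R]))//.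
by apply: bigcap_measurableType => k _; apply: measurableI;
  exact: measurable_coord_eq.
Qed.

End Matches.

Lemma match_exponent_ae_cst (R : realType) (A : pointedType)
    (mu : probability (borel_fullshift A) R)
    (P : fullshift A -> nat -> nat -> Prop) :
  shift_ergodic mu ->
  (forall w n m, P w n m.+1 -> P (Defs.shift w) n m) ->
  (forall n m, measurable [set w : borel_fullshift A | P w n m]) ->
  exists2 l : \bar R, 1 <= l & {ae mu, forall w, match_exponent R A P w = l}.
Proof.
move=> [inv erg] Pshift mP.
have [w0 w0E] := subinvariant_ae_cst _ _ _ mu _ (measurable_shift A) inv erg _
  (measurable_match_exponent R A P mP) (match_exponent_shift R A P Pshift).
by exists (match_exponent R A P w0) => //; exact: match_exponent_ge1.
Qed.

Theorem proposition2 (R : realType) (A : pointedType)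
    (finA : finite_set [set: A])
    (Omega : set (fullshift A)) (subO : subshift Omega)
    (mu : probability (borel_fullshift A) R) (muO : mu Omega = 1)
    (ergmu : shift_ergodic mu) :
  exists Rmu Tmu : \bar R,
    [/\ 1 <= Rmu, 1 <= Tmu &
        {ae mu, forall w, Omega w ->
           R_limsup R w = Rmu /\ T_limsup R w = Tmu}].
Proof.
have [Rmu Rmu1 RmuE] := match_exponent_ae_cst R A mu _ ergmu
  (R_match_shift A) (measurable_R_match A).
have [Tmu Tmu1 TmuE] := match_exponent_ae_cst R A mu _ ergmu
  (T_match_shift A) (measurable_T_match A).
exists Rmu, Tmu; split => //.
have aeF := ae_filter_ringOfSetsType mu.
by apply: filterS2 RmuE TmuE => w Rw Tw _; split; [exact: Rw|exact: Tw].
Qed.
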